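(* Let $\overline{\mathbf{CSTS}}$ be the full subcategory of $\mathbf{CSTS}$ of Cattani-Sassone transition systems having at most one state, and let $R^\perp:\mathbf{CSTS}\to\overline{\mathbf{CSTS}}$ be the left adjoint of the inclusion functor $\overline{\mathbf{CSTS}}\subset\mathbf{CSTS}$. Then $R^\perp$ induces a Quillen equivalence between the left determined Olschok model category $\mathbf{CSTS}$ and the category $\overline{\mathbf{CSTS}}$ equipped with the discrete model structure.
   Context: Fix an infinite set $\Sigma$ of labels. A transition presystem $X$ consists of a set $S(X)$ of states, a set $L(X)$ of actions with a labelling map $\mu:L(X)\to\Sigma$, and for each $n\geq 1$ a set $T_n(X)\subset S(X)\times L(X)^n\times S(X)$ of $n$-transitions; $T(X)=\bigcup_{n\geq 1}T_n(X)$. A map $f:X\to Y$ consists of a map $S(X)\to S(Y)$ and a label-preserving map $L(X)\to L(Y)$ such that the image $(f(\alpha),f(u_1),\dots,f(u_n),f(\beta))$ of every transition $(\alpha,u_1,\dots,u_n,\beta)$ of $X$ is a transition of $Y$. A Cattani-Sassone transition system is a transition presystem satisfying: (Multiset) if $(\alpha,u_1,\dots,u_n,\beta)$ is a transition with $n\geq2$, so is $(\alpha,u_{\sigma(1)},\dots,u_{\sigma(n)},\beta)$ for every permutation $\sigma$; (Patching) for $n\geq 3$, $p,q\geq 1$, $p+q<n$, if $(\alpha,u_1,\dots,u_n,\beta)$, $(\alpha,u_1,\dots,u_p,\nu_1)$, $(\nu_1,u_{p+1},\dots,u_n,\beta)$, $(\alpha,u_1,\dots,u_{p+q},\nu_2)$,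 $(\nu_2,u_{p+q+1},\dots,u_n,\beta)$ are transitions, so is $(\nu_1,u_{p+1},\dots,u_{p+q},\nu_2)$; (All actions used) every action $u$ occurs in some $1$-transition $(\alpha,u,\beta)$; (CSA2) for every transition $(\alpha,u_1,\dots,u_n,\beta)$ with $n\geq 2$ and every $1\leq p<n$ there is a unique state $\nu$ such that $(\alpha,u_1,\dots,u_p,\nu)$ and $(\nu,u_{p+1},\dots,u_n,\beta)$ are transitions; (CSA1) if $(\alpha,u,\beta)$ and $(\alpha,v,\beta)$ are transitions with $\mu(u)=\mu(v)$, then $u=v$. Their category is $\mathbf{CSTS}$. A set is identified with the object having it as set of states and no actions. Cubes. $C_n[x_1,\dots,x_n]$ ($n\geq 0$, $x_i\in\Sigma$) has states $\{0,1\}^n$, actions $(x_1,1),\dots,(x_n,n)$ with $\mu(x_i,i)=x_i$, and transitions all tuples $((\epsilon_1,\dots,\epsilon_n),(x_{i_1},i_1),\dots,(x_{i_d},i_d),(\epsilon'_1,\dots,\epsilon'_n))$, $d\geq1$, with $i_1,\dots,i_d$ distinct, $\epsilon_i\leq\epsilon'_i$ for all $i$, and $\epsilon_i\neq\epsilon'_i$ iff $i\in\{i_1,\dots,i_d\}$. For $n\geq1$, $\partial C_n[x_1,\dots,x_n]$ is obtained by removing all $n$-transitions (for $n=1$ it is the set $\{0,1\}$, without action). $C_0$ is the one-state set. $\uparrow\! x\!\uparrow$ has states $1,2,3,4$, one action $x$ (labelled $x$) and the transitions $(1,x,2)$, $(3,x,4)$. Let $\mathcal I=\{\varnothing\to\{0\}\}\cup\{\partial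 C_n[x_1,\dots,x_n]\subset C_n[x_1,\dots,x_n]\mid n\geq1, x_i\in\Sigma\}\cup\{C_0\sqcup C_0\sqcup C_1[x]\to\,\uparrow\! x\!\uparrow\;\mid x\in\Sigma\}$, the last maps being bijective on states. Let $\mathrm{inj}(\mathcal I)$ be the class of maps with the right lifting property with respect to $\mathcal I$ and $\mathrm{cof}(\mathcal I)$ the class of maps with the left lifting property with respect to $\mathrm{inj}(\mathcal I)$. Cylinder. A state $\alpha$ of $X$ is internal if there are transitions $(\gamma,u_1,\dots,u_n,\delta)$, $(\gamma,u_1,\dots,u_p,\alpha)$, $(\alpha,u_{p+1},\dots,u_n,\delta)$ with $n\geq2$, $1\leq p<n$; otherwise external. $\mathrm{Int}(X)$, $\mathrm{Ext}(X)$ denote the sets of internal and external states. $\mathrm{Cyl}(X)$ has states $\mathrm{Int}(X)\times\{0\}\sqcup\mathrm{Ext}(X)\times\{0,1\}$, actions $L(X)$, and transitions the tuples $((\alpha,\epsilon_0),u_1,\dots,u_n,(\beta,\epsilon_{n+1}))$ with $(\alpha,u_1,\dots,u_n,\beta)\in T(X)$; $\gamma^\epsilon:X\to\mathrm{Cyl}(X)$ is the identity on actions and sends a state $\alpha$ to $(\alpha,\epsilon)$ if $\alpha$ is external, to $(\alpha,0)$ if internal. Model structure. $\mathbf{CSTS}$ is equipped with the unique model structure with class of cofibrations $\mathrm{cof}(\mathcal I)$ and whose class of weak equivalences is the smallest class $\mathcal W$ containing $\mathrm{inj}(\mathcal I)$, closed under retracts and two-out-of-three, and such that $\mathcal W\cap\mathrm{cof}(\mathcal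 I)$ is closed under pushouts and transfinite compositions (left determined). All objects are cofibrant. Equivalently (Olschok construction): with $f\star\gamma^\epsilon$ and $f\star\gamma$ ($\gamma=\gamma^0\sqcup\gamma^1:\mathrm{Id}\sqcup\mathrm{Id}\Rightarrow\mathrm{Cyl}$) the pushout-corner maps (for $f:X\to Y$ and $\alpha:F\Rightarrow F'$, $f\star\alpha:F'X\sqcup_{FX}FY\to F'Y$), put $\Lambda_0=(\mathcal I\star\gamma^0)\cup(\mathcal I\star\gamma^1)$, $\Lambda_{n+1}=\Lambda_n\star\gamma$; the fibrant objects are those injective with respect to $\bigcup_n\Lambda_n$, and $f:X\to Y$ is a weak equivalence iff for every fibrant $Z$ precomposition with $f$ is a bijection $\pi(Y,Z)\to\pi(X,Z)$, where $\pi(X,Z)$ is the set of maps modulo the relation: there is $H:\mathrm{Cyl}(X)\to Z$ with $H\gamma^0=f$, $H\gamma^1=g$. The discrete model structure on a category: all maps are cofibrations and fibrations, the weak equivalences are the isomorphisms. ''$R^\perp$ induces a Quillen equivalence'' means that the adjunction between $R^\perp$ and the inclusion is a Quillen equivalence with left adjoint $R^\perp$. *)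

(* Defs.v *)
From mathcomp Require Import all_boot perm.
From mathcomp Require Import boolp classical_sets cardinality wochoice.

Set Implicit Arguments.
Unset Strict Implicit.
Unset Printing Implicit Defensive.

Record category := Category {
  ob : Type;
  hom : ob -> ob -> Type;
  idm : forall X, hom X X;
  comp : forall X Y Z, hom Y Z -> hom X Y -> hom X Z;
  comp_idl : forall X Y (f : hom X Y), comp (idm Y) f = f;
  comp_idr : forall X Y (f : hom X Y), comp f (idm X) = f;
  comp_assoc : forall X Y Z T (h : hom Z T) (g : hom Y Z) (f : hom X Y),
    comp h (comp g f) = comp (comp h g) f }.
Arguments hom {c} _ _.
Arguments idm {c} _.
Arguments comp {c X Y Z} _ _.

Declare Scope cat_scope.
Delimit Scope cat_scope with cat.
Notation "g '\oc' f" := (comp g f) (at level 50, left associativity) : cat_scope.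
Local Open Scope cat_scope.

Record functor (C D : category) := Functor {
  fob :> ob C -> ob D;
  fmap : forall X Y, hom X Y -> hom (fob X) (fob Y);
  fmap_id : forall X, fmap (idm X) = idm (fob X);
  fmap_comp : forall X Y Z (g : hom Y Z) (f : hom X Y),
    fmap (g \oc f) = fmap g \oc fmap f }.
Arguments fmap {C D} _ {X Y} _.

Record adjunction (C D : category) (L : functor C D) (R : functor D C) :=
  Adjunction {
  adj : forall X Y, hom (L X) Y -> hom X (R Y);
  adj_bij : forall X Y, bijective (@adj X Y);
  adj_natl : forall X X' Y (f : hom (L X) Y) (a : hom X' X),
    adj (f \oc fmap L a) = adj f \oc a;
  adj_natr : forall X Y Y' (f : hom (L X) Y) (b : hom Y Y'),
    adj (b \oc f) = fmap R b \oc adj f }.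
Arguments adj {C D L R} _ {X Y} _.

Definition full_subcategory (C : category) (P : ob C -> Prop) : category :=
  @Category {X : ob C | P X} (fun X Y => hom (sval X) (sval Y))
    (fun X => idm (sval X)) (fun X Y Z g f => g \oc f)
    (fun X Y f => comp_idl f) (fun X Y f => comp_idr f)
    (fun X Y Z T h g f => comp_assoc h g f).

Definition inclusion (C : category) (P : ob C -> Prop) :
    functor (full_subcategory P) C :=
  @Functor (full_subcategory P) C (fun X => sval X) (fun X Y f => f)
    (fun X => erefl) (fun X Y Z g f => erefl).

Definition mor_class (C : category) := forall X Y : ob C, hom X Y -> Prop.

Section Classes.
Variable C : category.
Implicit Types K W : mor_class C.

Definition is_iso : mor_class C := fun X Y f =>
  exists g : hom Y X, g \oc f = idm X /\ f \oc g = idm Y.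

Definition lifts (A B X Y : ob C) (i : hom A B) (p : hom X Y) :=
  forall (u : hom A X) (v : hom B Y), p \oc u = v \oc i ->
  exists h : hom B X, h \oc i = u /\ p \oc h = v.

Definition rlp K : mor_class C := fun X Y p =>
  forall A B (i : hom A B), K A B i -> lifts i p.

Definition llp K : mor_class C := fun A B i =>
  forall X Y (p : hom X Y), K X Y p -> lifts i p.

Definition class_and K W : mor_class C := fun X Y f => K X Y f /\ W X Y f.

Definition retract_of (X Y X' Y' : ob C) (f : hom X Y) (f' : hom X' Y') :=
  exists (s : hom X X') (r : hom X' X) (s' : hom Y Y') (r' : hom Y' Y),
    [/\ r \oc s = idm X, r' \oc s' = idm Y,
        f' \oc s = s' \oc f & f \oc r = r' \oc f'].

Definition retract_closed K :=
  forall X Y X' Y' (f : hom X Y) (f' : hom X' Y'),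
    retract_of f f' -> K X' Y' f' -> K X Y f.

Definition two_out_of_three K :=
  forall X Y Z (f : hom X Y) (g : hom Y Z),
    [/\ K X Y f -> K Y Z g -> K X Z (g \oc f),
        K X Y f -> K X Z (g \oc f) -> K Y Z g
      & K Y Z g -> K X Z (g \oc f) -> K X Y f].

Definition is_pushout (A B X Y : ob C)
    (i : hom A B) (u : hom A X) (v : hom B Y) (j : hom X Y) :=
  v \oc i = j \oc u /\
  forall (Z : ob C) (b : hom B Z) (x : hom X Z), b \oc i = x \oc u ->
    exists! h : hom Y Z, h \oc v = b /\ h \oc j = x.

Definition pushout_closed K :=
  forall A B X Y (i : hom A B) (u : hom A X) (v : hom B Y) (j : hom X Y),
    is_pushout i u v j -> K A B i -> K X Y j.

Record diagram (J : Type) (R : rel J) := Diagram {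
  dob :> J -> ob C;
  dmap : forall i j, R i j -> hom (dob i) (dob j);
  dmap_id : forall i (h : R i i), dmap h = idm (dob i);
  dmap_comp : forall i j k (hij : R i j) (hjk : R j k) (hik : R i k),
    dmap hik = dmap hjk \oc dmap hij }.

Section Colimit.
Variables (J : Type) (R : rel J) (D : diagram R) (P : J -> Prop).

Definition is_cocone (T : ob C) (t : forall i, P i -> hom (D i) T) :=
  forall i j (hi : P i) (hj : P j) (h : R i j), t j hj \oc dmap D h = t i hi.

(* Colimit of the restriction of D to the part P of the index set. *)
Definition is_colimit (T : ob C) (t : forall i, P i -> hom (D i) T) :=
  is_cocone t /\
  forall (Z : ob C) (z : forall i, P i -> hom (D i) Z), is_cocone z ->
    exists! h : hom T Z, forall i (hi : P i), h \oc t i hi = z i hi.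

End Colimit.

Section WellOrderedIndex.
Variables (J : eqType) (R : rel J).

Definition strictly_below (i j : J) : Prop := R i j /\ i != j.

Definition bottom (b : J) := forall i, R b i.

Definition successor (i j : J) :=
  strictly_below i j /\
  forall k, ~ (strictly_below i k /\ strictly_below k j).

Definition limit (j : J) := ~ bottom j /\ forall i, ~ successor i j.

(* A lambda-sequence of maps of K, lambda being the order type of R. *)
Definition sequence_in K (D : diagram R) :=
  (forall i j (h : R i j), successor i j -> K _ _ (dmap D h)) /\
  (forall j, limit j ->
     is_colimit (P := fun i => strictly_below i j)
                (fun i h => dmap D (proj1 h))).

End WellOrderedIndex.

Definition transfinite_closed K :=
  forall (J : eqType) (R : rel J) (b : J) (D : diagram R)
         (T : ob C) (t : forall i : J, True -> hom (D i) T),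
    well_order R -> bottom R b -> sequence_in K D -> is_colimit t ->
    K (D b) T (t b I).

(* Bicompleteness of C is not part of the structure. *)
Record model_structure := ModelStructure {
  cof : mor_class C;
  weq : mor_class C;
  fib : mor_class C;
  weq_two_out_of_three : two_out_of_three weq;
  cof_retract : retract_closed cof;
  weq_retract : retract_closed weq;
  fib_retract : retract_closed fib;
  trivial_cof_lifts : forall A B X Y (i : hom A B) (p : hom X Y),
    cof i -> weq i -> fib p -> lifts i p;
  trivial_fib_lifts : forall A B X Y (i : hom A B) (p : hom X Y),
    cof i -> fib p -> weq p -> lifts i p;
  trivial_cof_factor : forall X Y (f : hom X Y),
    exists Z (i : hom X Z) (p : hom Z Y),
      [/\ cof i, weq i, fib p & p \oc i = f];
  trivial_fib_factor : forall X Y (f : hom X Y),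
    exists Z (i : hom X Z) (p : hom Z Y),
      [/\ cof i, fib p, weq p & p \oc i = f] }.

Definition initial (O : ob C) := forall X, exists f : hom O X, forall g, g = f.
Definition terminal (O : ob C) := forall X, exists f : hom X O, forall g, g = f.

Definition cofibrant (M : model_structure) (X : ob C) :=
  exists O, initial O /\ exists f : hom O X, cof M f.
Definition fibrant (M : model_structure) (X : ob C) :=
  exists O, terminal O /\ exists f : hom X O, fib M f.

Definition inj_class K : mor_class C := rlp K.
Definition cof_class K : mor_class C := llp (rlp K).

Record localizer K W : Prop := Localizer {
  localizer_inj : forall X Y (f : hom X Y), inj_class K f -> W X Y f;
  localizer_retract : retract_closed W;
  localizer_two_out_of_three : two_out_of_three W;
  localizer_pushout : pushout_closed (class_and W (cof_class K));
  localizer_transfinite : transfinite_closed (class_and W (cof_class K)) }.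

Definition smallest_localizer K : mor_class C := fun X Y f =>
  forall W, localizer K W -> W X Y f.

(* fib M is then determined: it is the class rlp (class_and (cof M) (weq M)). *)
Definition left_determined_by K (M : model_structure) :=
  (forall X Y (f : hom X Y), cof M f <-> cof_class K f) /\
  (forall X Y (f : hom X Y), weq M f <-> smallest_localizer K f).

Lemma iso_two_out_of_three : two_out_of_three is_iso.
Proof.
move=> X Y Z f g; split.
- move=> [f' [f'f ff']] [g' [g'g gg']]; exists (f' \oc g'); split.
    by rewrite comp_assoc -(comp_assoc f') g'g comp_idr.
  by rewrite comp_assoc -(comp_assoc g) ff' comp_idr.
- move=> [f' [f'f ff']] [k [kgf gfk]]; exists (f \oc k); split; last first.
    by rewrite comp_assoc.
  have kg : k \oc g = f'.
    by rewrite -[k \oc g]comp_idr -ff' comp_assoc -(comp_assoc k) kgf comp_idl.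
  by rewrite -comp_assoc kg.
- move=> [g' [g'g gg']] [k [kgf gfk]]; exists (k \oc g); split.
    by rewrite -comp_assoc.
  have fk : f \oc k = g'.
    by rewrite -[f \oc k]comp_idl -g'g -comp_assoc (comp_assoc g) gfk comp_idr.
  by rewrite comp_assoc fk.
Qed.

Lemma iso_retract_closed : retract_closed is_iso.
Proof.
move=> X Y X' Y' f f' [s [r [s' [r' [rs r's' f's fr]]]]] [g [gf' f'g]].
exists (r \oc g \oc s'); split.
  by rewrite -comp_assoc -f's comp_assoc -(comp_assoc r) gf' comp_idr.
by rewrite 2!comp_assoc fr -(comp_assoc r') f'g comp_idr.
Qed.

Lemma iso_lifts_left A B X Y (i : hom A B) (p : hom X Y) :
  is_iso i -> lifts i p.
Proof.
move=> [j [ji ij]] u v e; exists (u \oc j); split.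
  by rewrite -comp_assoc ji comp_idr.
by rewrite comp_assoc e -comp_assoc ij comp_idr.
Qed.

Lemma iso_lifts_right A B X Y (i : hom A B) (p : hom X Y) :
  is_iso p -> lifts i p.
Proof.
move=> [q [qp pq]] u v e; exists (q \oc v); split.
  by rewrite -comp_assoc -e comp_assoc qp comp_idl.
by rewrite comp_assoc pq comp_idl.
Qed.

Lemma iso_idm (X : ob C) : is_iso (idm X).
Proof. by exists (idm X); rewrite comp_idl. Qed.

Definition all_maps : mor_class C := fun X Y f => True.

Definition discrete_model : model_structure.
Proof.
refine (@ModelStructure all_maps is_iso all_maps iso_two_out_of_three
  _ iso_retract_closed _ _ _ _ _) => //.
- by move=> A B X Y i p _ iso_i _; apply: iso_lifts_left.
- by move=> A B X Y i p _ _ iso_p; apply: iso_lifts_right.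
- move=> X Y f; exists X, (idm X), f; split=> //; first exact: iso_idm.
  exact: comp_idr.
- move=> X Y f; exists Y, f, (idm Y); split=> //; first exact: iso_idm.
  exact: comp_idl.
Defined.

End Classes.

Section Quillen.
Variables (C D : category) (M : model_structure C) (N : model_structure D).
Variables (L : functor C D) (R : functor D C) (A : adjunction L R).

Definition quillen_adjunction :=
  (forall X Y (f : hom X Y), cof M f -> cof N (fmap L f)) /\
  (forall X Y (f : hom X Y), cof M f -> weq M f ->
     cof N (fmap L f) /\ weq N (fmap L f)).

Definition quillen_equivalence :=
  quillen_adjunction /\
  forall X Y (f : hom (L X) Y), cofibrant M X -> fibrant N Y ->
    (weq N f <-> weq M (adj A f)).

End Quillen.

(* T_n is encoded as the set of triples (a, u, b) in trans with size u = n;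
   since n >= 1, there is none with u empty. *)
Record presystem (Sigma : Type) := Presystem {
  state : Type;
  action : Type;
  label : action -> Sigma;
  trans : state -> seq action -> state -> Prop;
  trans_neq0 : forall a b, ~ trans a [::] b }.

Section Presystems.
Variable Sigma : Type.
Implicit Types X Y : presystem Sigma.

Record ts_map X Y := TSMap {
  on_state : state X -> state Y;
  on_action : action X -> action Y;
  on_action_label : forall u, label (on_action u) = label u;
  on_trans : forall a u b, trans a u b ->
    trans (on_state a) (map on_action u) (on_state b) }.

Lemma ts_map_eq X Y (f g : ts_map X Y) :
  on_state f =1 on_state g -> on_action f =1 on_action g -> f = g.
Proof.
case: f g => [fs fa fl ft] [gs ga gl gt] /= /funext es /funext ea.
by case: _ / es in gt *; case: _ / ea in gl gt *; congr TSMap.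
Qed.

Program Definition ts_id X : ts_map X X := @TSMap X X id id _ _.
Next Obligation. by rewrite map_id. Qed.

Program Definition ts_comp X Y Z (g : ts_map Y Z) (f : ts_map X Y) :
  ts_map X Z :=
  @TSMap X Z (on_state g \o on_state f) (on_action g \o on_action f) _ _.
Next Obligation. by rewrite !on_action_label. Qed.
Next Obligation. by rewrite map_comp; do 2!apply: on_trans. Qed.

Definition presystems : category.
Proof.
refine (@Category (presystem Sigma) ts_map ts_id ts_comp _ _ _);
  by move=> *; apply: ts_map_eq.
Defined.

Definition multiset_axiom X :=
  forall n (t : n.-tuple (action X)) (s : 'S_n) a b, (2 <= n)%N ->
    trans a t b -> trans a [tuple tnth t (s i) | i < n] b.

Definition patching_axiom X :=
  forall (u v w : seq (action X)) a b c d,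
    (0 < size u)%N -> (0 < size v)%N -> (0 < size w)%N ->
    trans a (u ++ v ++ w) b ->
    trans a u c -> trans c (v ++ w) b ->
    trans a (u ++ v) d -> trans d w b ->
    trans c v d.

Definition all_actions_used X :=
  forall u : action X, exists a b, trans a [:: u] b.

Definition CSA2 X :=
  forall (u v : seq (action X)) a b,
    (0 < size u)%N -> (0 < size v)%N -> trans a (u ++ v) b ->
    exists! c, trans a u c /\ trans c v b.

Definition CSA1 X :=
  forall (u v : action X) a b,
    trans a [:: u] b -> trans a [:: v] b -> label u = label v -> u = v.

Record is_csts X : Prop := IsCSTS {
  csts_multiset : multiset_axiom X;
  csts_patching : patching_axiom X;
  csts_all_used : all_actions_used X;
  csts_CSA2 : CSA2 X;
  csts_CSA1 : CSA1 X }.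

Definition CSTS : category :=
  @full_subcategory presystems (fun X => is_csts X).

Definition at_most_one_state (X : ob CSTS) :=
  forall a b : state (sval X), a = b.

Definition CSTS1 : category := full_subcategory at_most_one_state.

Definition CSTS1_inclusion : functor CSTS1 CSTS := inclusion at_most_one_state.

Program Definition set_presystem (T : Type) : presystem Sigma :=
  @Presystem Sigma T void (of_void Sigma) (fun _ _ _ => False) _.

Lemma set_is_csts T : is_csts (set_presystem T).
Proof. by split=> //; case. Qed.

Definition set_csts (T : Type) : ob CSTS := exist _ _ (set_is_csts T).

Section Cube.
Variables (n : nat) (x : n.-tuple Sigma).

(* The action (x_i, i) is encoded by its index i. *)
Definition cube_trans (e : {ffun 'I_n -> bool}) (u : seq 'I_n)
    (e' : {ffun 'I_n -> bool}) : Prop :=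
  [/\ (0 < size u)%N, uniq u, forall i, (e i <= e' i)%N
    & forall i, (e i != e' i) = (i \in u)].

Program Definition cube_presystem : presystem Sigma :=
  @Presystem Sigma {ffun 'I_n -> bool} 'I_n (tnth x) cube_trans _.
Next Obligation. by case. Qed.

(* All actions are kept when n >= 2, none when n = 1. *)
Definition boundary_action := {i : 'I_n | (2 <= n)%N}.

Program Definition boundary_presystem : presystem Sigma :=
  @Presystem Sigma {ffun 'I_n -> bool} boundary_action
    (fun i => tnth x (val i))
    (fun e u e' => cube_trans e (map val u) e' /\ size u <> n) _.
Next Obligation. by case; case. Qed.

End Cube.

Section CubeAxioms.
Variable n : nat.
Implicit Types (u v w : seq 'I_n) (e : {ffun 'I_n -> bool}).

Lemma cube_trans_perm u v e e' :
  perm_eq u v -> cube_trans e u e' -> cube_trans e v e'.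
Proof.
move=> uv [s0 uu le ne]; split=> //.
- by rewrite -(perm_size uv).
- by rewrite -(perm_uniq uv).
- by move=> i; rewrite -(perm_mem uv).
Qed.

Lemma cube_trans_patching u v w a b c d : (0 < size v)%N ->
  cube_trans a (u ++ v ++ w) b -> cube_trans a u c -> cube_trans a (u ++ v) d ->
  cube_trans c v d.
Proof.
move=> v0 [_ uniq_uvw _ _] [_ _ le_ac ne_ac] [_ uniq_uv le_ad ne_ad].
have uniqv : uniq v by move: uniq_uv; rewrite cat_uniq => /and3P[].
have disj i : i \in u -> i \in v -> False.
  move: uniq_uv; rewrite cat_uniq => /and3P[_ /hasPn h _] iu /h.
  by rewrite /= iu.
split=> // i; have := le_ac i; have := le_ad i; have := ne_ac i;
  have := ne_ad i; have := @disj i; rewrite mem_cat;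
  case: (i \in u) (i \in v) => [] []; case: (a i) (c i) (d i) => [] [] [] //=;
  by move=> /(_ isT isT).
Qed.

Lemma cube_trans_CSA2 u v a b : (0 < size u)%N -> (0 < size v)%N ->
  cube_trans a (u ++ v) b ->
  exists! c, cube_trans a u c /\ cube_trans c v b.
Proof.
move=> u0 v0 [_ uniq_uv le_ab ne_ab].
have [uniqu uniqv] : uniq u /\ uniq v.
  by move: uniq_uv; rewrite cat_uniq => /and3P[].
have disj i : i \in u -> i \in v -> False.
  move: uniq_uv; rewrite cat_uniq => /and3P[_ /hasPn h _] iu /h.
  by rewrite /= iu.
exists [ffun i => a i || (i \in u)]; split.
  split; split=> // i; rewrite ?ffunE; have := le_ab i; have := ne_ab i;
  have := @disj i; rewrite mem_cat;
  case: (i \in u) (i \in v) => [] []; case: (a i) (b i) => [] [] //=;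
  by move=> /(_ isT isT).
move=> c [[_ _ le_ac ne_ac] _]; apply/ffunP => i; rewrite ffunE.
by have := le_ac i; have := ne_ac i; case: (a i) (c i) (i \in u) => [] [] [].
Qed.

Lemma cube_trans_CSA1 (i j : 'I_n) a b :
  cube_trans a [:: i] b -> cube_trans a [:: j] b -> i = j.
Proof.
move=> [_ _ _ ne_i] [_ _ _ ne_j].
by apply/eqP; have := ne_j i; rewrite ne_i !inE eqxx.
Qed.

Lemma cube_trans_used (i : 'I_n) : exists a b, cube_trans a [:: i] b.
Proof.
exists [ffun=> false], [ffun j => j == i]; split=> // j; rewrite !ffunE //.
by rewrite inE; case: (j == i).
Qed.

Lemma perm_tuple_perm (T : eqType) m (t : m.-tuple T) (s : 'S_m) :
  perm_eq t [tuple tnth t (s i) | i < m].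
Proof. by rewrite perm_sym; apply/tuple_permP; exists s. Qed.

Variable x : n.-tuple Sigma.

Lemma cube_is_csts : is_csts (cube_presystem x).
Proof.
split.
- move=> m t s a b _; apply: cube_trans_perm; exact: perm_tuple_perm.
- move=> u v w a b c d _ v0 _ abuvw acu _ aduv _.
  exact: cube_trans_patching abuvw acu aduv.
- exact: cube_trans_used.
- exact: cube_trans_CSA2.
- by move=> i j a b ai aj _; apply: cube_trans_CSA1 ai aj.
Qed.

Lemma boundary_is_csts : is_csts (boundary_presystem x).
Proof.
have short u e e' : cube_trans e u e' -> (size u <= n)%N.
  by move=> [_ uu _ _]; rewrite -(card_uniqP uu) -[leqRHS]card_ord max_card.
split.
- move=> m t s a b _ [abt ltn]; split; last by move: ltn; rewrite !size_tuple.
  by apply: cube_trans_perm abt; apply/perm_map/perm_tuple_perm.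
- move=> u v w a b c d u0 v0 w0 [abuvw _] [acu _] _ [aduv _] _.
  move: abuvw acu aduv; rewrite !map_cat => abuvw acu aduv; split.
    by apply: cube_trans_patching abuvw acu aduv; rewrite size_map.
  have := short _ _ _ abuvw; rewrite !size_cat !size_map => le_n e.
  by move: le_n; rewrite e leqNgt addnCA -[ltnLHS]addn0 ltn_add2l addn_gt0 u0.
- move=> [i n2]; have [a [b abi]] := cube_trans_used i.
  by exists a, b; split=> //= e; rewrite -e in n2.
- move=> u v a b u0 v0 [abuv ne_n].
  have := short _ _ _ abuv; rewrite size_map size_cat => le_n.
  move: abuv; rewrite map_cat => abuv.
  have [|| c [[acu cbv] cE]] := cube_trans_CSA2 _ _ abuv; rewrite ?size_map //.
  exists c; split.
    split; split=> //; apply/eqP; rewrite ltn_eqF // (leq_trans _ le_n) //.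
      by rewrite -addn1 leq_add2l.
    by rewrite -add1n leq_add2r.
  by move=> c' [[? _] [? _]]; apply: cE.
- by move=> i j a b [ai _] [aj _] _; apply/val_inj/(cube_trans_CSA1 ai aj).
Qed.

Definition cube : ob CSTS := exist _ _ cube_is_csts.
Definition boundary : ob CSTS := exist _ _ boundary_is_csts.

Program Definition boundary_to_cube : hom boundary cube :=
  @TSMap (boundary_presystem x) (cube_presystem x) id val _ _.

End CubeAxioms.

(* The coproduct of a set T, seen as a transition system, and X; as T has no
   action, the actions are those of X. *)
Section SetCoproduct.
Variables (T : Type) (X : presystem Sigma).

Definition set_sum_trans (a : T + state X) (u : seq (action X))
    (b : T + state X) : Prop :=
  match a, b with inr a, inr b => trans a u b | _, _ => False end.

Program Definition set_sum_presystem : presystem Sigma :=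
  @Presystem Sigma (T + state X)%type (action X) (@label _ X) set_sum_trans _.
Next Obligation. by case: a b => a [] b //= /trans_neq0. Qed.

Lemma set_sum_is_csts : is_csts X -> is_csts set_sum_presystem.
Proof.
move=> HX; split.
- by move=> m t s [] a [] b //; apply: (csts_multiset HX).
- by move=> u v w [] a [] b [] c [] d //; apply: (csts_patching HX).
- by move=> u; have [a [b abu]] := csts_all_used HX u; exists (inr a), (inr b).
- move=> u v [] a [] b //= u0 v0 /(csts_CSA2 HX u0 v0) [c [acb cE]].
  by exists (inr c); split=> // -[] d [] // ad db; rewrite (cE d).
- by move=> u v [] a [] b //; apply: (csts_CSA1 HX).
Qed.

End SetCoproduct.

Definition set_sum (T : Type) (X : ob CSTS) : ob CSTS :=
  exist _ _ (set_sum_is_csts T (proj2_sig X)).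

Program Definition set_sum_inl T (X : ob CSTS) : hom (set_csts T) (set_sum T X) :=
  @TSMap (set_presystem T) (set_sum_presystem T (sval X)) inl (of_void _) _ _.
Next Obligation. by case: u. Qed.

Program Definition set_sum_inr T (X : ob CSTS) : hom X (set_sum T X) :=
  @TSMap (sval X) (set_sum_presystem T (sval X)) inr id _ _.
Next Obligation. by rewrite map_id. Qed.

Lemma set_sum_coproduct T (X Z : ob CSTS)
    (f : hom (set_csts T) Z) (g : hom X Z) :
  exists! h : hom (set_sum T X) Z,
    h \oc set_sum_inl T X = f /\ h \oc set_sum_inr T X = g.
Proof.
pose hs (a : T + state (sval X)) :=
  match a with inl a => on_state f a | inr a => on_state g a end.
have ht (a : T + state (sval X)) u b : set_sum_trans a u b ->
    trans (hs a) (map (on_action g) u) (hs b).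
  by case: a b => a [] b //=; apply: on_trans.
exists (@TSMap (set_sum_presystem T (sval X)) (sval Z) hs (on_action g)
          (on_action_label g) ht); split.
  by split; apply: ts_map_eq => //; case.
move=> k [kl kr]; subst f g; apply: ts_map_eq => //; by case.
Qed.

Section DoubleArrow.
Variable x : Sigma.

(* The states 1, 2, 3, 4. *)
Inductive four_states := s1 | s2 | s3 | s4.

Definition double_arrow_trans (a : four_states) (u : seq unit)
    (b : four_states) : Prop :=
  match a, u, b with
  | s1, [:: _], s2 | s3, [:: _], s4 => True
  | _, _, _ => False
  end.

Program Definition double_arrow_presystem : presystem Sigma :=
  @Presystem Sigma four_states unit (fun=> x) double_arrow_trans _.
Next Obligation. by case: a b => [] []. Qed.

Lemma double_arrow_is_csts : is_csts double_arrow_presystem.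
Proof.
have size1 a u b : double_arrow_trans a u b -> size u = 1.
  by case: a u b => [] [|? []] // [].
split.
- by move=> m t s a b m2 /size1; rewrite size_tuple => e; rewrite e in m2.
- move=> u v w a b c d u0 v0 w0 /size1; rewrite !size_cat => e.
  by have := leq_add u0 (leq_add v0 w0); rewrite e.
- by move=> []; exists s1, s2.
- move=> u v a b u0 v0 /size1; rewrite size_cat => e.
  by have := leq_add u0 v0; rewrite e.
- by move=> [] [].
Qed.

Definition double_arrow : ob CSTS := exist _ _ double_arrow_is_csts.

(* C_0 |_| C_0 |_| C_1[x], with C_0 |_| C_0 the set of booleans. *)
Definition split_arrow : ob CSTS := set_sum bool (cube [tuple x]).

Definition split_to_double_state (a : bool + {ffun 'I_1 -> bool}) :=
  match a with
  | inr e => if e ord0 then s2 else s1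
  | inl b => if b then s4 else s3
  end.

Lemma split_to_double_trans a u b :
  trans (p := sval split_arrow) a u b ->
  double_arrow_trans (split_to_double_state a) (map (fun=> tt) u)
    (split_to_double_state b).
Proof.
case: a b => a [] b //= [u0 uu le ne].
have /esym := ne ord0; have := le ord0.
have : (size u <= 1)%N by rewrite -(card_uniqP uu) -[leqRHS](card_ord 1) max_card.
case: u u0 {uu le ne} => [|i []] // _ _; rewrite [i]ord1 inE eqxx.
by case: (a ord0) (b ord0) => [] [].
Qed.

Program Definition split_to_double : hom split_arrow double_arrow :=
  @TSMap (sval split_arrow) double_arrow_presystem
    split_to_double_state (fun=> tt) _ split_to_double_trans.
Next Obligation. by rewrite [u]ord1. Qed.

Lemma split_to_double_bij : bijective split_to_double_state.
Proof.
exists (fun s => match s with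
  | s1 => inr [ffun=> false] | s2 => inr [ffun=> true]
  | s3 => inl false | s4 => inl true end); last by case=> //=; rewrite ffunE.
case=> [[] //|e /=]; case e0: (e ord0); congr inr; apply/ffunP => i;
  by rewrite ffunE [i]ord1 e0.
Qed.

End DoubleArrow.

Program Definition empty_to_point : hom (set_csts void) (set_csts unit) :=
  @TSMap (set_presystem void) (set_presystem unit) (of_void _) id _ _.

Inductive generating_cof : mor_class CSTS :=
| GenPoint : generating_cof empty_to_point
| GenBoundary n (x : n.+1.-tuple Sigma) : generating_cof (boundary_to_cube x)
| GenArrow (x : Sigma) : generating_cof (split_to_double x).

End Presystems.

(* Main.v *)
Require Import Defs.
From mathcomp Require Import all_boot boolp classical_sets cardinality.
From mathcomp Require Import perm wochoice.

(* A localizer contains the maps in inj, so every weak equivalence is orthogonal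
   to the one-state systems as soon as the orthogonal maps form a localizer.
   The main point there is that a map in inj reflects n-transitions: an
   n-transition extends, by CSA2 and patching, to a map from the n-cube, which
   is lifted by induction on n.  Conversely, let e : X -> Y be orthogonal to
   the one-state systems, with Y one-state, and factor e as a trivial
   cofibration X -> Z and a fibration Z -> Y.  Lifting against the trivial
   cofibration C_0 + C_0 + C_1[x] -> Cyl(C_1[x]) shows that whether [a -u-> b]
   is a transition of Z does not depend on a and b; hence collapsing the states
   of Z is a map in inj, and the collapse of Z is isomorphic to Y. *)

Set Implicit Arguments.
Unset Strict Implicit.
Unset Printing Implicit Defensive.

Local Open Scope cat_scope.

(** * Well-founded induction along a well-ordered index *)

Section WellOrder.
Variables (J : eqType) (R : rel J).
Hypothesis wo_R : well_order R.

Let chain_R : wo_chain R predT.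
Proof. by move=> A _; apply: wo_R. Qed.

Lemma well_order_total : total R.
Proof. by move=> i j; apply: (wo_chainW chain_R). Qed.

Lemma well_order_anti : antisymmetric R.
Proof. by move=> i j; apply: (wo_chain_antisymmetric chain_R). Qed.

Lemma well_order_lt_total i j :
  [\/ strictly_below R i j, i = j | strictly_below R j i].
Proof.
have [->|ne_ij] := eqVneq i j; first by constructor 2.
case/orP: (well_order_total i j) => [Rij|Rji]; first by constructor 1.
by constructor 3; split; rewrite // eq_sym.
Qed.

(** If some index were not accessible, a least such index would have only accessible strict
    predecessors, hence be accessible. *)
Lemma strictly_below_wf : well_founded (strictly_below R).
Proof.
move=> j; apply: contrapT => nacc_j.
have [|m [[/asboolP nacc_m m_min] _]] :=
  wo_R (A := [pred i | `[< ~ Acc (strictly_below R) i >]]).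
  by exists j; apply/asboolP.
apply: nacc_m; split=> i [Rim ne_im]; apply: contrapT => nacc_i.
have Rmi : R m i by apply: m_min; apply/asboolP.
by case/eqP: ne_im; apply: well_order_anti; rewrite Rim.
Qed.

Lemma successor_below i j k :
  successor R i j -> strictly_below R k j -> k = i \/ strictly_below R k i.
Proof.
move=> [lt_ij none] lt_kj.
have [||lt_ik] := well_order_lt_total k i; [by right|by left|].
by case: (none k).
Qed.

Lemma well_order_cases (j : J) :
  [\/ bottom R j, exists i, successor R i j | limit R j].
Proof.
have [bot_j|nbot_j] := EM (bottom R j); first by constructor 1.
have [suc_j|nsuc_j] := EM (exists i, successor R i j); first by constructor 2.
by constructor 3; split=> // i suc_i; apply: nsuc_j; exists i.
Qed.

End WellOrder.

(** * Extending a map along a transfinite sequence *)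

Section TransfiniteExtension.
Variables (C : category) (J : eqType) (R : rel J) (b : J) (D : diagram C R).
Hypotheses (wo_R : well_order R) (bot_b : bottom R b).
Variable (K : mor_class C).
Hypothesis seq_D : sequence_in K D.

Lemma limit_neq_bottom j : limit R j -> strictly_below R b j.
Proof.
move=> [nbot _]; split; first exact: bot_b.
by apply/eqP => e; subst j; apply: nbot.
Qed.

Section Extension.
Variables (X : ob C) (G : forall j, hom (D j) X -> Prop) (u : hom (D b) X).
Hypothesis G_u : G u.
Hypothesis G_successor : forall i j (h : R i j) (z : hom (D i) X),
  successor R i j -> G z -> exists2 z' : hom (D j) X, z' \oc dmap D h = z & G z'.
Hypothesis G_limit : forall j (z : hom (D j) X), limit R j ->
  (forall i (h : R i j), strictly_below R i j -> G (z \oc dmap D h)) -> G z.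

(** The last clause asks for [Some], so it also asserts that every earlier choice succeeded. *)
Let good j (z : forall i, strictly_below R i j -> option (hom (D i) X))
    (h : hom (D j) X) :=
  [/\ G h, forall Rbj : R b j, h \oc dmap D Rbj = u
    & forall i (lt_ij : strictly_below R i j) (Rij : R i j),
        z i lt_ij = Some (h \oc dmap D Rij)].

Let step j (z : forall i, strictly_below R i j -> option (hom (D i) X)) :
    option (hom (D j) X) :=
  match pselect (exists h, good z h) with
  | left e => Some (sval (cid e))
  | right _ => None
  end.

(* The extension along stage j is chosen among those that restrict to the
   previous choices; option accounts for the possibility that none exists. *)
Let ext : forall j, option (hom (D j) X) :=
  Fix (strictly_below_wf wo_R) (fun j => option (hom (D j) X)) step.

Let extE j : ext j = step (fun i (_ : strictly_below R i j) => ext i).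
Proof.
rewrite /ext Fix_eq // => i f g e; congr step.
by apply: functional_extensionality_dep => k; apply: functional_extensionality_dep.
Qed.

Let ext_good j h : ext j = Some h ->
  good (fun i (_ : strictly_below R i j) => ext i) h.
Proof. by rewrite extE /step; case: pselect => // e [<-]; case: cid. Qed.

(** Transfinite induction: take [u] at the bottom, extend the previous choice at a successor, glue
    the earlier choices along the colimit at a limit. *)
Let ext_exists j : exists h, ext j = Some h.
Proof.
elim/(well_founded_ind (strictly_below_wf wo_R)): j => j IH.
suff [h good_h] : exists h, good (fun i (_ : strictly_below R i j) => ext i) h.
  by rewrite extE /step; case: pselect => [e|[]]; [exists (sval (cid e))|exists h].
have [bot_j|[i suc_ij]|lim_j] := well_order_cases R j.
- have e : b = j by apply: (well_order_anti wo_R); rewrite bot_b bot_j.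
  subst j; exists u; split=> // [Rbb|i [Rib ne_ib]]; first by rewrite dmap_id comp_idr.
  by case/eqP: ne_ib; apply: (well_order_anti wo_R); rewrite Rib bot_b.
- have lt_ij := proj1 suc_ij; have Rij := proj1 lt_ij.
  have [z zE] := IH i lt_ij; have [G_z z_u z_lt] := ext_good zE.
  have [h hz G_h] := G_successor Rij suc_ij G_z; exists h; split=> //.
    by move=> Rbj; rewrite (dmap_comp D (bot_b i) Rij Rbj) comp_assoc hz z_u.
  move=> k lt_kj Rkj; have [e|lt_ki] := successor_below wo_R suc_ij lt_kj.
    by subst k; rewrite zE -hz; congr (Some (_ \oc dmap D _)); apply: bool_irrelevance.
  have Rki := proj1 lt_ki.
  by rewrite (z_lt k lt_ki Rki) (dmap_comp D Rki Rij Rkj) comp_assoc hz.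
- pose z i (lt_ij : strictly_below R i j) := sval (cid (IH i lt_ij)).
  have zE i lt_ij : ext i = Some (z i lt_ij) by rewrite /z; case: cid.
  have z_cocone : is_cocone z.
    move=> i k lt_ij lt_kj Rik; have [_ _ z_lt] := ext_good (zE _ lt_kj).
    have [e|ne_ik] := eqVneq i k.
      subst k; rewrite dmap_id comp_idr; congr z; exact: Prop_irrelevance.
    by have /= := z_lt i (conj Rik ne_ik) Rik; rewrite (zE _ lt_ij) => -[].
  have [h [hz _]] := (proj2 (proj2 seq_D j lim_j)) X z z_cocone.
  have hz' i (lt_ij : strictly_below R i j) (Rij : R i j) :
      h \oc dmap D Rij = z i lt_ij.
    by rewrite -hz; congr (_ \oc dmap D _); apply: bool_irrelevance.
  exists h; split.
  + apply: G_limit => // i Rij lt_ij; rewrite (hz' i lt_ij).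
    by have [] := ext_good (zE _ lt_ij).
  + move=> Rbj; have lt_bj := limit_neq_bottom lim_j.
    rewrite (hz' b lt_bj); have [_ zb _] := ext_good (zE _ lt_bj).
    by rewrite -(zb (bot_b b)) dmap_id comp_idr.
  + by move=> i lt_ij Rij; rewrite (hz' i lt_ij).
Qed.

(** The predicate [G] lets one construction serve twice: it is the lower triangle of a lifting
    problem for left lifting classes, and trivial for orthogonality. *)
Lemma transfinite_extension : exists z : forall j, True -> hom (D j) X,
  [/\ is_cocone z, z b I = u & forall j, G (z j I)].
Proof.
pose z j (_ : True) := sval (cid (ext_exists j)).
have zE j : ext j = Some (z j I) by rewrite /z; case: cid.
exists z; split.
- move=> i k [] [] Rik; have [_ _ z_lt] := ext_good (zE k).
  have [e|ne_ik] := eqVneq i k; first by subst k; rewrite dmap_id comp_idr.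
  by have /= := z_lt i (conj Rik ne_ik) Rik; rewrite zE => -[].
- by have [_ zb _] := ext_good (zE b); rewrite -(zb (bot_b b)) dmap_id comp_idr.
- by move=> j; have [] := ext_good (zE j).
Qed.

End Extension.

(** Agreement passes to a successor by cancelling the connecting map, and to a limit by uniqueness
    of maps out of a colimit. *)
Lemma transfinite_uniqueness X (z z' : forall j, hom (D j) X) :
    (forall i j (h : R i j), z j \oc dmap D h = z i) ->
    (forall i j (h : R i j), z' j \oc dmap D h = z' i) ->
    (forall i j (h : R i j), successor R i j ->
       forall f g : hom (D j) X, f \oc dmap D h = g \oc dmap D h -> f = g) ->
  z b = z' b -> forall j, z j = z' j.
Proof.
move=> zc zc' uniq_suc eb; elim/(well_founded_ind (strictly_below_wf wo_R)) => j IH.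
have [bot_j|[i suc_ij]|lim_j] := well_order_cases R j.
- have e : b = j by apply: (well_order_anti wo_R); rewrite bot_b bot_j.
  by subst j.
- have lt_ij := proj1 suc_ij; apply: (uniq_suc _ _ (proj1 lt_ij) suc_ij).
  by rewrite zc zc' IH.
- have [_ colim] := proj2 seq_D j lim_j.
  have [|h [_ hU]] := colim X (fun i _ => z i); first by move=> i k *; apply: zc.
  by rewrite -(hU (z j)) ?(hU (z' j)) // => i lt_ij; rewrite ?zc ?zc' ?IH.
Qed.

End TransfiniteExtension.

(** * Stability of left lifting classes *)

Section LeftLifting.
Variables (C : category) (K : mor_class C).

Lemma llp_pushout : pushout_closed (llp K).
Proof.
move=> A B X Y i u v j [vi po] llp_i E F p Kp f g pf.
have [|h [hi ph]] := llp_i _ _ p Kp (f \oc u) (g \oc v).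
  by rewrite comp_assoc pf -!comp_assoc vi.
have [k [[kv kj] _]] := po E h f hi; exists k; split=> //.
(* The lower triangle commutes because both maps solve the same problem out of the pushout. *)
have [|l [_ lU]] := po F (g \oc v) (g \oc j); first by rewrite -!comp_assoc vi.
by rewrite -(lU (p \oc k)) ?(lU g) // -!comp_assoc kv kj ph pf.
Qed.

Lemma llp_transfinite : transfinite_closed (llp K).
Proof.
move=> J R b D T t wo_R bot_b seq_D [t_cocone colim] E F p Kp u v pu.
have [|i j h z suc_ij pz|j z lim_j pz|z [zc zb pz]] := @transfinite_extension
    C J R b D wo_R bot_b _ seq_D E (fun j z => p \oc z = v \oc t j I) u.
- exact: pu.
- have [|z' [z'z pz']] := proj1 seq_D i j h suc_ij _ _ p Kp z (v \oc t j I).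
    by rewrite pz -comp_assoc (t_cocone _ _ I I).
  by exists z'.
(* At a limit, the two maps to [F] agree on all earlier stages, hence agree. *)
- have [_ colim_j] := proj2 seq_D j lim_j.
  have [|h [_ hU]] :=
      colim_j F (fun i lt_ij => p \oc z \oc dmap D (proj1 lt_ij)).
    move=> i k lt_ij lt_kj Rik.
    by rewrite (dmap_comp D Rik (proj1 lt_kj) (proj1 lt_ij)) comp_assoc.
  rewrite -(hU (p \oc z)) // -(hU (v \oc t j I)) // => i lt_ij.
  by rewrite -(comp_assoc v) (t_cocone _ _ I I) -comp_assoc pz.
have [h [hz _]] := colim E z zc; exists h; rewrite hz; split=> //.
have [|k [_ kU]] := colim F (fun i hi => v \oc t i hi).
  by move=> i k hi hk Rik; rewrite -comp_assoc (t_cocone _ _ hi hk Rik).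
by rewrite -(kU v) // -(kU (p \oc h)) // => i []; rewrite -comp_assoc hz.
Qed.

End LeftLifting.

(** * Maps orthogonal to a full subcategory *)

Section Orthogonality.
Variables (C : category) (P : ob C -> Prop).

Definition orthogonal : mor_class C := fun X Y f =>
  forall T, P T -> forall g : hom X T, exists! h : hom Y T, h \oc f = g.

Lemma orthogonal_cancel X Y T (f : hom X Y) (h k : hom Y T) :
  orthogonal f -> P T -> h \oc f = k \oc f -> h = k.
Proof.
by move=> of_ PT e; have [l [_ lU]] := of_ T PT (k \oc f); rewrite -(lU h) ?(lU k).
Qed.

Lemma orthogonal_iso X Y (f : hom X Y) : P X -> P Y -> orthogonal f -> is_iso f.
Proof.
move=> PX PY of_; have [h [hf _]] := of_ X PX (idm X); exists h; split=> //.
by apply: (orthogonal_cancel of_ PY); rewrite -comp_assoc hf comp_idr comp_idl.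
Qed.

Lemma orthogonal_retract : retract_closed orthogonal.
Proof.
move=> X Y X' Y' f f' [s [r [s' [r' [rs r's' f's fr]]]]] of' T PT g.
have [h [hf' _]] := of' T PT (g \oc r); exists (h \oc s'); split.
  by rewrite -comp_assoc -f's comp_assoc hf' -comp_assoc rs comp_idr.
move=> k kf; have -> : h = k \oc r'.
  by apply: (orthogonal_cancel of' PT); rewrite hf' -comp_assoc -fr comp_assoc kf.
by rewrite -comp_assoc r's' comp_idr.
Qed.

Lemma orthogonal_two_out_of_three : two_out_of_three orthogonal.
Proof.
move=> X Y Z f g; split=> [of_ og|of_ ogf|og ogf] T PT k.
- have [h [hf _]] := of_ T PT k; have [l [lg _]] := og T PT h.
  exists l; split=> [|l' l'gf]; first by rewrite comp_assoc lg.
  apply: (orthogonal_cancel og PT); rewrite lg.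
  by apply: (orthogonal_cancel of_ PT); rewrite hf -comp_assoc l'gf.
- have [l [lgf _]] := ogf T PT (k \oc f); exists l; split=> [|l' l'g].
    by apply: (orthogonal_cancel of_ PT); rewrite -comp_assoc.
  by apply: (orthogonal_cancel ogf PT); rewrite lgf comp_assoc l'g.
- have [l [lgf _]] := ogf T PT k; exists (l \oc g).
  split=> [|h hf]; first by rewrite -comp_assoc.
  (* A competitor [h] is first extended along [g], so that it can be compared after [g \oc f]. *)
  have [m [mg _]] := og T PT h; rewrite -mg; congr (_ \oc _).
  by apply: (orthogonal_cancel ogf PT); rewrite lgf comp_assoc mg.
Qed.

Lemma orthogonal_pushout : pushout_closed orthogonal.
Proof.
move=> A B X Y i u v j [vi po] oi T PT g.
have [h [hi _]] := oi T PT (g \oc u); have [k [[kv kj] kU]] := po T h g hi.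
exists k; split=> // k' k'j; apply: kU; split=> //.
by apply: (orthogonal_cancel oi PT); rewrite -comp_assoc vi comp_assoc k'j.
Qed.

Lemma orthogonal_transfinite : transfinite_closed orthogonal.
Proof.
move=> J R b D T t wo_R bot_b seq_D [t_cocone colim] E PE u.
have [||//|z [zc zb _]] := @transfinite_extension
    C J R b D wo_R bot_b _ seq_D E (fun j z => True) u; first by [].
  move=> i j h z suc_ij _; have [z' [z'z _]] := proj1 seq_D i j h suc_ij E PE z.
  by exists z'.
have [h [hz hU]] := colim E z zc; exists h; split=> [|h' h't]; first by rewrite hz.
apply: hU => j []; symmetry.
apply: (transfinite_uniqueness wo_R bot_b seq_D (z := fun j => z j I)
   (z' := fun j => h' \oc t j I)).
- by move=> i k; apply: zc.
- by move=> i k Rik; rewrite -comp_assoc (t_cocone _ _ I I).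
- by move=> i k h0 suc_ik f g; apply: orthogonal_cancel (proj1 seq_D i k h0 suc_ik) PE.
- by rewrite zb.
Qed.

(** Pushouts and transfinite compositions concern the intersection with the cofibrations, whose two
    halves are stable separately. *)
Lemma orthogonal_localizer (K : mor_class C) :
  (forall X Y (f : hom X Y), inj_class K f -> orthogonal f) ->
  localizer K orthogonal.
Proof.
move=> inj_orth; split=> //.
- exact: orthogonal_retract.
- exact: orthogonal_two_out_of_three.
- move=> A B X Y i u v j po [oi ci]; split; first exact: orthogonal_pushout po oi.
  exact: llp_pushout po ci.
- move=> J R b D T t wo_R bot_b [seq_suc seq_lim] colim; split.
    apply: orthogonal_transfinite colim => //; split=> // i j h suc_ij.
    exact: (proj1 (seq_suc i j h suc_ij)).
  apply: llp_transfinite colim => //; split=> // i j h suc_ij.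
  exact: (proj2 (seq_suc i j h suc_ij)).
Qed.

(** * Orthogonality and the reflector *)

Section Reflector.
Variables (L : functor C (full_subcategory P)) (A : adjunction L (inclusion P)).

(** The transpose of [f] is the unit followed by [f], so it is orthogonal exactly when [Y] is
    another reflection of [X]. *)
Lemma is_iso_orthogonal X Y (f : hom (L X) Y) :
  is_iso f <-> orthogonal (adj A f).
Proof.
split=> [[g [gf fg]] T PT k|of_].
  have [m am ma] := adj_bij A X (exist _ T PT).
  exists (m k \oc g : hom Y (exist P T PT)); split.
    have := adj_natr A f (m k \oc g : hom Y (exist P T PT)).
    by rewrite -comp_assoc gf comp_idr ma /= => <-.
  move=> h hf; have -> : m k = (h : hom Y (exist P T PT)) \oc f.
    by apply: (can_inj am); rewrite ma adj_natr.
  by rewrite -(comp_assoc (c := full_subcategory P)) fg comp_idr.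
(* The inverse of [f] is the extension of the unit [adj A (idm (L X))] along the transpose of
   [f]. *)
have [k [kf _]] := of_ (sval (L X)) (svalP (L X)) (adj A (idm (L X))).
have kf1 : (k : hom Y (L X)) \oc f = idm (L X).
  by apply: (bij_inj (adj_bij A X (L X))); rewrite adj_natr.
exists k; split=> //.
apply: (orthogonal_cancel of_ (svalP Y)).
have := adj_natr A f (f \oc (k : hom Y (L X))).
rewrite -comp_assoc kf1 comp_idr /= => <-; exact: esym (comp_idl _).
Qed.

(** By naturality, the transpose of [fmap L f] is [f] followed by the unit of [Y], a composite of
    orthogonal maps. *)
Lemma orthogonal_reflect_iso X Y (f : hom X Y) :
  orthogonal f -> is_iso (fmap L f).
Proof.
move=> of_; apply/is_iso_orthogonal.
rewrite -[fmap L f]comp_idl adj_natl.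
have [+ _ _] := orthogonal_two_out_of_three f (adj A (idm (L Y))); apply=> //.
by apply/is_iso_orthogonal; apply: iso_idm.
Qed.

End Reflector.
End Orthogonality.

(** * Extending an n-transition to a map from the n-cube *)

Section Cubes.
Variables (Sigma : Type) (X : presystem Sigma).
Hypothesis csts_X : is_csts X.

(** The word is an image [map f s] because [perm_eq] needs decidable equality, which [action X] does
    not carry. *)
Lemma trans_perm (T : eqType) (f : T -> action X) s s' a b :
  perm_eq s s' -> trans a (map f s) b -> trans a (map f s') b.
Proof.
move=> ss' tr; have [s_le1|s_gt1] := leqP (size s) 1.
  by rewrite -(perm_small_eq _ ss') // -(perm_size ss').
pose t := [tuple of map f (in_tuple s)].
have sz : size s' == size s by rewrite (perm_size ss').
have /tuple_permP[q s'E] : perm_eq (Tuple sz) (in_tuple s) by rewrite perm_sym.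
suff -> : map f s' = [tuple tnth t (q i) | i < size s].
  exact: (csts_multiset csts_X).
rewrite [s']s'E /= -map_comp; apply: eq_map => i /=.
by rewrite tnth_map.
Qed.

(* The empty word is added as an identity transition, so that the extreme
   vertices of a cube need no separate treatment. *)
Definition wtrans (a : state X) (s : seq (action X)) (b : state X) :=
  if s is [::] then a = b else trans a s b.

Lemma wtransP a s b : (0 < size s)%N -> wtrans a s b = trans a s b.
Proof. by case: s. Qed.

Lemma wtrans_perm (T : eqType) (f : T -> action X) s s' a b :
  perm_eq s s' -> wtrans a (map f s) b -> wtrans a (map f s') b.
Proof.
case: s => [|i s] ss'; first by have /nilP-> : nilp s' by rewrite /nilp -(perm_size ss').
have s'_gt0 : (0 < size s')%N by rewrite -(perm_size ss').
by rewrite (wtransP _ _ (s := map f s')) ?size_map //; apply: trans_perm.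
Qed.

Lemma wtrans_cat a s t b :
  wtrans a (s ++ t) b -> exists! c, wtrans a s c /\ wtrans c t b.
Proof.
case: s => [|u s]; first by move=> tr; exists a; split=> // c [].
case: t => [|v t].
  by rewrite cats0 => tr; exists b; split=> // c [].
exact: (csts_CSA2 csts_X (u := u :: s) (v := v :: t)).
Qed.

(** With an empty outer word the conclusion is one of the hypotheses; with an empty middle word it
    is the uniqueness in CSA2. *)
Lemma wtrans_patch (u v w : seq (action X)) a b c d :
  wtrans a (u ++ v ++ w) b -> wtrans a u c -> wtrans c (v ++ w) b ->
  wtrans a (u ++ v) d -> wtrans d w b -> wtrans c v d.
Proof.
case: v => [|v0 v].
  rewrite cats0 => tr tr1 tr2 tr3 tr4.
  have [e [_ eU]] := wtrans_cat tr.
  by rewrite /= -(eU c) // -(eU d).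
case: u => [|u0 u]; first by move=> _ /= <-.
case: w => [|w0 w]; first by move=> _ _ + _ /= ->; rewrite cats0.
exact: (csts_patching csts_X (u := u0 :: u) (v := v0 :: v) (w := w0 :: w)).
Qed.

Variables (n : nat) (w : 'I_n -> action X) (a b : state X).
Hypothesis (n_gt0 : (0 < n)%N) (trans_w : trans a (map w (enum 'I_n)) b).

Let coords (P : pred 'I_n) := [seq i <- enum 'I_n | P i].

(** Listing the coordinates where [e] is 1 before the others permutes the whole word, and CSA2
    splits the transition at that point. *)
Lemma cube_vertices_exist : exists c : {ffun 'I_n -> bool} -> state X,
  forall e : {ffun 'I_n -> bool}, wtrans a (map w (coords e)) (c e) /\
            wtrans (c e) (map w (coords (predC e))) b.
Proof.
suff /choice[c cP] : forall e : {ffun 'I_n -> bool}, exists c,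
    wtrans a (map w (coords e)) c /\ wtrans c (map w (coords (predC e))) b.
  by exists c.
move=> e.
have : wtrans a (map w (coords e ++ coords (predC e))) b.
  apply: wtrans_perm (_ : wtrans a (map w (enum 'I_n)) b).
    by rewrite perm_sym; apply/permPl/perm_filterC.
  by rewrite wtransP // size_map size_enum_ord.
by rewrite map_cat => /wtrans_cat[c []]; exists c.
Qed.

Definition cube_vertex := sval (cid cube_vertices_exist).

Lemma cube_vertexP (e : {ffun 'I_n -> bool}) : wtrans a (map w (coords e)) (cube_vertex e) /\
  wtrans (cube_vertex e) (map w (coords (predC e))) b.
Proof. by rewrite /cube_vertex; case: cid. Qed.

Lemma cube_vertex0 : cube_vertex [ffun=> false] = a.
Proof.
have [+ _] := cube_vertexP [ffun=> false]; rewrite /coords (@eq_filter _ _ pred0).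
  by rewrite filter_pred0.
by move=> i; rewrite /= ffunE.
Qed.

Lemma cube_vertex1 : cube_vertex [ffun=> true] = b.
Proof.
have [_] := cube_vertexP [ffun=> true]; rewrite /coords (@eq_filter _ _ pred0).
  by rewrite filter_pred0.
by move=> i; rewrite /= ffunE.
Qed.

(** The full word can be arranged as the ones of [e], then [s], then the zeros of [e']; patching
    extracts the middle part. *)
Lemma cube_vertex_trans e s e' : cube_trans e s e' ->
  trans (cube_vertex e) (map w s) (cube_vertex e').
Proof.
move=> [s_gt0 uniq_s le_ee' ne_ee'].
have [ae eb] := cube_vertexP e; have [ae' e'b] := cube_vertexP e'.
have uniq_c P : uniq (coords P) by rewrite filter_uniq ?enum_uniq.
have mem_c P i : (i \in coords P) = P i by rewrite mem_filter mem_enum andbT.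
have disj i : i \in s -> e i = false /\ e' i = true.
  by rewrite -ne_ee'; have := le_ee' i; case: (e i) (e' i) => [] [].
have same i : i \notin s -> e i = e' i by rewrite -ne_ee' negbK => /eqP.
have perm_e' : perm_eq (coords e') (coords e ++ s).
  apply: uniq_perm => // [|i].
    rewrite cat_uniq uniq_c uniq_s andbT; apply/hasPn => i /disj[ei _] /=.
    by rewrite mem_c ei.
  rewrite mem_cat !mem_c; have [/disj[-> ->] //|/same ->] := boolP (i \in s).
  by rewrite orbF.
have perm_e : perm_eq (coords (predC e)) (s ++ coords (predC e')).
  apply: uniq_perm => // [|i].
    rewrite cat_uniq uniq_c uniq_s andbT; apply/hasPn => i.
    by rewrite mem_c /= => e'i; apply: contra e'i => /disj[].
  by rewrite mem_cat !mem_c /=; have [/disj[-> _] //|/same ->] := boolP (i \in s).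
rewrite -wtransP ?size_map //.
apply: (@wtrans_patch (map w (coords e)) _ (map w (coords (predC e'))) a b) => //.
- rewrite -!map_cat; apply: wtrans_perm (_ : wtrans a (map w (enum 'I_n)) b).
    rewrite catA perm_sym; apply: perm_trans (_ : perm_eq _ (coords e' ++ coords (predC e'))) _.
      by rewrite perm_cat2r perm_sym.
    exact/permPl/perm_filterC.
  by rewrite wtransP // size_map size_enum_ord.
- by rewrite -map_cat; apply: wtrans_perm eb.
- by rewrite -map_cat; apply: wtrans_perm ae'.
Qed.

Definition cube_labels := [tuple label (w i) | i < n].

Lemma cube_labelsE i : label (w i) = tnth cube_labels i.
Proof. by rewrite tnth_mktuple. Qed.

Definition cube_map : ts_map (cube_presystem cube_labels) X :=
  @TSMap _ (cube_presystem cube_labels) X cube_vertex w cube_labelsE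
    cube_vertex_trans.

End Cubes.

(** * Maps with the right lifting property *)

Section InjectiveMaps.
Variable Sigma : Type.
Implicit Types X Y Z : ob (CSTS Sigma).

Lemma hom_eq X Y (f g : hom X Y) :
  on_state f =1 on_state g -> on_action f =1 on_action g -> f = g.
Proof. exact: ts_map_eq. Qed.

Lemma on_state_eq X Y (f g : hom X Y) : f = g -> on_state f =1 on_state g.
Proof. by move=> ->. Qed.

Lemma on_action_eq X Y (f g : hom X Y) : f = g -> on_action f =1 on_action g.
Proof. by move=> ->. Qed.

Lemma generating_cof_inj_state X Y (i : hom X Y) :
  generating_cof i -> injective (on_state i).
Proof. by case=> [[]|n x|x] //=; apply: bij_inj (split_to_double_bij). Qed.

(** A lift is forced on actions. On states it extends [u] by chosen preimages, which is consistent
    since generating cofibrations are injective on states; reflection of transitions makes it a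
    map. *)
Lemma cartesian_inj X Y (p : hom X Y) :
    bijective (on_action p) -> (forall y, exists x, on_state p x = y) ->
    (forall a s b, trans (on_state p a) (map (on_action p) s) (on_state p b) ->
       trans a s b) ->
  inj_class (@generating_cof Sigma) p.
Proof.
move=> [q pq qp] p_surj p_refl A B i /generating_cof_inj_state inj_i u v pu.
have pus a : on_state p (on_state u a) = on_state v (on_state i a).
  exact: (on_state_eq pu a).
have pua a : on_action p (on_action u a) = on_action v (on_action i a).
  exact: (on_action_eq pu a).
have [hs hsP] : exists hs : state (sval B) -> state (sval X),
    forall y, on_state p (hs y) = on_state v y /\
              forall a, on_state i a = y -> hs y = on_state u a.
  suff /choice[hs hsP] : forall y, exists x, on_state p x = on_state v y /\
      forall a, on_state i a = y -> x = on_state u a by exists hs.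
  move=> y.
  have [[a <-]|na] := EM (exists a, on_state i a = y).
    by exists (on_state u a); split=> // a' /inj_i ->.
  have [x px] := p_surj (on_state v y); exists x; split=> // a ia.
  by case: na; exists a.
have hl w : label (q (on_action v w)) = label w.
  by rewrite -(on_action_label p) qp on_action_label.
have ht a s b : trans a s b ->
    trans (hs a) (map (q \o on_action v) s) (hs b).
  move=> /(on_trans v) tr; apply: p_refl.
  rewrite (proj1 (hsP a)) (proj1 (hsP b)) map_comp -map_comp.
  by rewrite (eq_map (g := id)) ?map_id.
exists (@TSMap _ (sval B) (sval X) hs (q \o on_action v) hl ht); split.
  apply: hom_eq => a /=; first exact: (proj2 (hsP _)).
  by rewrite -pua pq.
apply: hom_eq => a /=; first by case: (hsP a).
by rewrite qp.
Qed.

(** * Maps out of the split and double arrows *)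

Section ArrowMaps.
Variables (X : ob (CSTS Sigma)) (x : Sigma) (u : action (sval X)).
Variables (a b c d : state (sval X)).
Hypothesis label_u : label u = x.
Hypothesis trans_ab : trans a [:: u] b.

Definition split_state (s : bool + {ffun 'I_1 -> bool}) : state (sval X) :=
  match s with
  | inl e => if e then d else c
  | inr e => if e ord0 then b else a
  end.

Lemma split_map_trans s t s' : trans (p := sval (split_arrow x)) s t s' ->
  trans (split_state s) (map (fun=> u) t) (split_state s').
Proof.
move=> tr; have := split_to_double_trans tr; case: s s' tr => s [] s' //= _.
by case: (s ord0) (s' ord0) t => [] [] [|? []].
Qed.

Lemma split_map_label (i : 'I_1) : label u = tnth [tuple x] i.
Proof. by rewrite [i]ord1. Qed.

Definition split_map : hom (split_arrow x) X :=
  @TSMap _ (sval (split_arrow x)) (sval X) split_state (fun=> u)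
    split_map_label split_map_trans.

Hypothesis trans_cd : trans c [:: u] d.

Definition double_state s : state (sval X) :=
  match s with s1 => a | s2 => b | s3 => c | s4 => d end.

Lemma double_map_trans s t s' : double_arrow_trans s t s' ->
  trans (double_state s) (map (fun=> u) t) (double_state s').
Proof. by case: s s' t => [] [] [|? []]. Qed.

Definition double_map : hom (double_arrow x) X :=
  @TSMap _ (sval (double_arrow x)) (sval X) double_state (fun=> u)
    (fun=> label_u) double_map_trans.

End ArrowMaps.

(** * Lifting transitions along an injective map *)

Section InjectiveMap.
Variables (X Y : ob (CSTS Sigma)) (p : hom X Y).
Hypothesis inj_p : inj_class (@generating_cof Sigma) p.

Lemma inj_state_surj y : exists x, on_state p x = y.
Proof.
have tr (u : seq void) : False -> trans y (map (of_void _) u) y by [].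
pose v : hom (set_csts Sigma unit) Y :=
  @TSMap _ (set_presystem Sigma unit) (sval Y) (fun=> y) (of_void _)
    (fun u => match u with end) (fun _ u _ => tr u).
pose u : hom (set_csts Sigma void) X :=
  @TSMap _ (set_presystem Sigma void) (sval X) (of_void _) (of_void _)
    (fun u => match u with end) (fun _ u _ e => match e with end).
have [|h [_ ph]] := inj_p (GenPoint Sigma) (u := u) (v := v).
  by apply: hom_eq => -[].
by exists (on_state h tt); apply: (on_state_eq ph tt).
Qed.

(** The lift against [split_to_double] gives both arrows the same action, so the second one becomes
    a transition by [u]. *)
Lemma inj_trans1 u a b c d : trans a [:: u] b ->
  trans (on_state p c) [:: on_action p u] (on_state p d) -> trans c [:: u] d.
Proof.
move=> ab cd; have pab := on_trans p ab.
have lu := on_action_label p u.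
have [|h [hi _]] := inj_p (GenArrow (label u)) (u := split_map c d erefl ab)
    (v := double_map lu pab cd).
  apply: hom_eq => //=; case=> [[] //|e /=]; by case: (e ord0).
have /= := on_trans h (a := s3) (u := [:: tt]) (b := s4) I.
have := on_state_eq hi (inl false) => /= ->.
have := on_state_eq hi (inl true) => /= ->.
by have := on_action_eq hi ord0 => /= ->.
Qed.

(** If [u] and [v] have the same image, then [u] also acts between the ends of a transition by [v],
    and CSA1 identifies them. *)
Lemma inj_action_inj : injective (on_action p).
Proof.
move=> u v uv; have [a [b ab]] := csts_all_used (svalP X) u.
have [c [d cd]] := csts_all_used (svalP X) v.
apply: (csts_CSA1 (svalP X) (a := c) (b := d)) => //.
  by apply: inj_trans1 ab _; rewrite uv; apply: (on_trans p cd).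
by rewrite -(on_action_label p) uv on_action_label.
Qed.

Section CubeLifting.
Variable sg : state (sval Y) -> state (sval X).
Hypothesis sgK : cancel sg (on_state p).

(** Once the boundary of the cube spanned by the transition is lifted, lifting against the boundary
    inclusion fills it, and the main diagonal of the filled cube is the transition sought. *)
Lemma inj_lift_cube n (w : 'I_n.+1 -> action (sval Y)) a b
    (ab : trans a (map w (enum 'I_n.+1)) b)
    (t : boundary_action n.+1 -> action (sval X)) :
    (forall i, on_action p (t i) = w (val i)) ->
    (forall s e e', size s <> n.+1 -> cube_trans e (map val s) e' ->
      trans (sg (cube_vertex (svalP Y) (ltn0Sn n) ab e)) (map t s)
            (sg (cube_vertex (svalP Y) (ltn0Sn n) ab e'))) ->
  exists2 h : 'I_n.+1 -> action (sval X),
    forall i, on_action p (h i) = w i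
    & trans (sg a) (map h (enum 'I_n.+1)) (sg b).
Proof.
move=> pt trans_t; set c := cube_vertex _ _ _ in trans_t.
pose v : hom (cube (cube_labels w)) Y := cube_map (svalP Y) (ltn0Sn n) ab.
have tl i : label (t i) = tnth (cube_labels w) (val i).
  by rewrite -cube_labelsE -pt on_action_label.
pose u : hom (boundary (cube_labels w)) X :=
  @TSMap _ (boundary_presystem (cube_labels w)) (sval X) (sg \o c) t tl
    (fun e s e' ee' => trans_t s e e' (proj2 ee') (proj1 ee')).
have [|h [hi ph]] := inj_p (GenBoundary (cube_labels w)) (u := u) (v := v).
  by apply: hom_eq => e /=.
exists (on_action h); first by move=> i; apply: (on_action_eq ph i).
have := on_trans h (a := [ffun=> false]) (u := enum 'I_n.+1) (b := [ffun=> true]).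
have hs e : on_state h e = sg (c e) by apply: (on_state_eq hi e).
rewrite !hs /c cube_vertex0 cube_vertex1; apply; split.
- by rewrite size_enum_ord.
- exact: enum_uniq.
- by move=> i; rewrite !ffunE.
- by move=> i; rewrite !ffunE mem_enum.
Qed.

Lemma inj_action_surj v : exists u, on_action p u = v.
Proof.
have [a [b ab]] := csts_all_used (svalP Y) v.
have ab' : trans a (map (fun _ : 'I_1 => v) (enum 'I_1)) b.
  by have := size_enum_ord 1; case: (enum _) => [|i []].
(* The boundary of [C_1] has no action, so nothing has to be lifted beforehand. *)
have none (i : boundary_action 1) : False by case: i.
have [i||h ph _] := inj_lift_cube (ab := ab')
  (t := fun i => match none i with end).
- by case: (none i).
- by move=> [|i s] e e' _ [] //; case: (none i).
by exists (h ord0).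
Qed.

Variable tau : action (sval Y) -> action (sval X).
Hypothesis tauK : cancel tau (on_action p).

(** Strong induction on the length: proper faces of the cube carry shorter words, already lifted. *)
Lemma inj_lift_trans a s b :
  trans a s b -> trans (sg a) (map tau s) (sg b).
Proof.
have [m] := ubnP (size s); elim: m s a b => // m IH s a b le_sm ab.
have s_gt0 : (0 < size s)%N by case: s ab {le_sm} => // /trans_neq0.
have [n sz] : exists n, size s = n.+1 by exists (size s).-1; rewrite prednK.
pose w := tnth (Tuple (introT eqP sz)).
have ws : map w (enum 'I_n.+1) = s by rewrite map_tnth_enum.
have ab' : trans a (map w (enum 'I_n.+1)) b by rewrite ws.
have [i|r e e' ne_r ee'|h ph] := inj_lift_cube (ab := ab') (t := tau \o w \o val).
- exact: tauK.
- rewrite (map_comp _ val) (map_comp tau); apply: IH; last exact: cube_vertex_trans.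
  have [_ uniq_r _ _] := ee'; rewrite !size_map.
  (* A repetition-free word in [n.+1] letters whose length is not [n.+1] is shorter. *)
  have := max_card (mem (map val r)); rewrite (card_uniqP uniq_r) card_ord.
  rewrite leq_eqVlt size_map (introF eqP ne_r) /= => lt_r.
  by apply: leq_trans lt_r _; rewrite -sz -ltnS.
- have hE : h =1 tau \o w by move=> i; apply: inj_action_inj; rewrite ph /= tauK.
  by rewrite (eq_map hE) (map_comp tau w) ws.
Qed.

End CubeLifting.

Lemma inj_orthogonal : orthogonal (@at_most_one_state Sigma) p.
Proof.
move=> T T1 g; have [sg sgK] := choice inj_state_surj.
have [tau tauK] := choice (inj_action_surj sgK).
have hl v : label (on_action g (tau v)) = label v.
  by rewrite on_action_label -(on_action_label p) tauK.
have ht a s b : trans a s b -> trans (on_state g (sg a))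
    (map (on_action g \o tau) s) (on_state g (sg b)).
  by move=> ab; rewrite map_comp; apply: (on_trans g); apply: inj_lift_trans.
exists (@TSMap _ (sval Y) (sval T) (on_state g \o sg) (on_action g \o tau) hl ht).
split; first apply: hom_eq => [a|u] /=.
- exact: T1.
- by congr (on_action g _); apply: inj_action_inj; rewrite tauK.
move=> h hp; apply: hom_eq => [a|v] /=; first exact: T1.
by rewrite -hp /= tauK.
Qed.

End InjectiveMap.
End InjectiveMaps.

(** * Sets as systems, and adding isolated states *)

Section DiscreteSystems.
Variable Sigma : Type.
Implicit Types (S T : Type) (X Z : ob (CSTS Sigma)).

Program Definition set_map S T (f : S -> T) : hom (set_csts Sigma S) (set_csts Sigma T) :=
  @TSMap _ (set_presystem Sigma S) (set_presystem Sigma T) f id _ _.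

Definition states_map X : hom (set_csts Sigma (state (sval X))) X :=
  @TSMap _ (set_presystem Sigma (state (sval X))) (sval X) id (of_void _)
    (fun u => match u with end) (fun _ _ _ e => match e with end).

(** Presents the inclusion of [X] into its sum with [T] as a pushout of a map of sets, along which
    weak equivalences that are cofibrations can be transported. *)
Lemma set_sum_pushout T X :
  is_pushout (set_map (@inr T (state (sval X)))) (states_map X)
    (states_map (set_sum T X)) (set_sum_inr T X).
Proof.
split=> [|Z f g fg]; first by apply: hom_eq => // -[].
have fgs a : on_state f (inr a) = on_state g a := on_state_eq fg a.
have ht a s b : trans (p := sval (set_sum T X)) a s b ->
    trans (on_state f a) (map (on_action g) s) (on_state f b).
  by case: a b => a [] b //= ab; rewrite !fgs; apply: (on_trans g).
exists (@TSMap _ (sval (set_sum T X)) (sval Z) (on_state f) (on_action g)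
          (on_action_label g) ht); split.
  by split; apply: hom_eq => //; case.
by move=> h [hf hg]; subst f g; apply: hom_eq.
Qed.

Lemma set_map_inr_cof S T :
  cof_class (@generating_cof Sigma) (set_map (@inr T S)).
Proof.
move=> X Y p inj_p u v pu; have [sg sgK] := choice (inj_state_surj inj_p).
pose hs (a : T + S) := match a with
  | inl a => sg (on_state v (inl a)) | inr a => on_state u a end.
exists (@TSMap _ (set_presystem Sigma (T + S)) (sval X) hs (of_void _)
  (fun i => match i with end) (fun _ _ _ e => match e with end)).
split; apply: hom_eq => //; try by case.
by case=> a /=; [rewrite sgK | apply: (on_state_eq pu a)].
Qed.

Lemma set_map_surj_inj S T (f : S -> T) (g : T -> S) :
  cancel g f -> inj_class (@generating_cof Sigma) (set_map f).
Proof.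
move=> gK; apply: cartesian_inj => //; first by exists id.
by move=> y; exists (g y); apply: gK.
Qed.

End DiscreteSystems.

(** * The cylinder of the 1-cube *)

Section CompleteArrow.
Variables (Sigma : Type) (x : Sigma).

Definition complete_arrow_trans (a : bool * bool) (s : seq unit) (b : bool * bool) :=
  [/\ a.1 = false, size s = 1 & b.1 = true].

(* This is Cyl(C_1[x]), with (e, k) the state (e, k) of the cylinder. *)
Program Definition complete_arrow_presystem : presystem Sigma :=
  @Presystem Sigma (bool * bool) unit (fun=> x) complete_arrow_trans _.
Next Obligation. by case. Qed.

Lemma complete_arrow_is_csts : is_csts complete_arrow_presystem.
Proof.
split.
- by move=> m t s a b m2 [_]; rewrite size_tuple => e; rewrite e in m2.
- move=> u v w a b c d u0 v0 w0 [_]; rewrite !size_cat => e.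
  by have := leq_add u0 (leq_add v0 w0); rewrite e.
- by move=> []; exists (false, false), (true, false).
- move=> u v a b u0 v0 [_]; rewrite size_cat => e.
  by have := leq_add u0 v0; rewrite e.
- by move=> [] [].
Qed.

Definition complete_arrow : ob (CSTS Sigma) := exist _ _ complete_arrow_is_csts.

Lemma cube1_trans e s e' : cube_trans e s e' ->
  [/\ e (ord0 : 'I_1) = false, size s = 1 & e' ord0 = true].
Proof.
move=> tr; have := @split_to_double_trans Sigma x (inr e) s (inr e') tr.
by rewrite /=; case: (e ord0) (e' ord0) s {tr} => [] [] [|? []].
Qed.

Definition split_to_complete_state (a : bool + {ffun 'I_1 -> bool}) :=
  match a with inl b => (b, true) | inr e => (e ord0, false) end.

Lemma split_to_complete_trans a s b :
  trans (p := sval (split_arrow x)) a s b ->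
  complete_arrow_trans (split_to_complete_state a) (map (fun=> tt) s)
    (split_to_complete_state b).
Proof.
case: a b => a [] b //= /cube1_trans[a0 s1 b1].
by split; rewrite ?size_map.
Qed.

Program Definition split_to_complete : hom (split_arrow x) complete_arrow :=
  @TSMap _ (sval (split_arrow x)) complete_arrow_presystem
    split_to_complete_state (fun=> tt) _ split_to_complete_trans.
Next Obligation. by rewrite [u]ord1. Qed.

Lemma complete_to_cube_trans a s b : complete_arrow_trans a s b ->
  cube_trans [ffun=> a.1] (map (fun=> ord0 : 'I_1) s) [ffun=> b.1].
Proof.
case: a b => a a' [b b'] [/= -> s1 ->]; case: s s1 => [|? []] // _.
by split=> // i; rewrite !ffunE // [i]ord1.
Qed.

Program Definition complete_to_cube : hom complete_arrow (cube [tuple x]) :=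
  @TSMap _ complete_arrow_presystem (cube_presystem [tuple x])
    (fun a => [ffun=> a.1]) (fun=> ord0) _ complete_to_cube_trans.

Lemma complete_to_cube_inj : inj_class (@generating_cof Sigma) complete_to_cube.
Proof.
apply: cartesian_inj.
- by exists (fun=> tt) => [[]|i] //; rewrite [i]ord1.
- move=> e; exists (e ord0, false); apply/ffunP => i.
  by rewrite [i]ord1 ffunE.
- move=> a s b /cube1_trans; rewrite !ffunE size_map; exact.
Qed.

(** The map is bijective on states and actions, so the lift is determined; [inj_trans1] supplies the
    added transitions from the original one [w1]. *)
Lemma split_to_complete_cof : cof_class (@generating_cof Sigma) split_to_complete.
Proof.
move=> X Y p inj_p u v pu.
pose hs (a : bool * bool) : state (sval X) :=
  on_state u (if a.2 then inl a.1 else inr [ffun=> a.1]).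
have hsE a : on_state p (hs a) = on_state v a.
  rewrite -[on_state p _]/(on_state (p \oc u) _) pu /=; congr on_state.
  by case: a => b [] //=; rewrite ffunE.
pose w := on_action u ord0.
have pw : on_action p w = on_action v tt := on_action_eq pu ord0.
have w1 : trans (on_state u (inr [ffun=> false])) [:: w] (on_state u (inr [ffun=> true])).
  apply: (on_trans u (a := inr _) (u := [:: ord0]) (b := inr _)).
  by split=> // i; rewrite !ffunE // [i]ord1.
have ht a s b : complete_arrow_trans a s b -> trans (hs a) (map (fun=> w) s) (hs b).
  case: s => [|i [|? ?]] [a0 // _ b1]; apply: (inj_trans1 inj_p w1).
  rewrite !hsE pw.
  by apply: (on_trans v (a := a) (u := [:: tt])).
have hl i : label w = label (p := complete_arrow_presystem) i.
  by rewrite on_action_label.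
exists (@TSMap _ complete_arrow_presystem (sval X) hs (fun=> w) hl ht); split.
  apply: hom_eq => a /=; last by rewrite [a]ord1.
  rewrite /hs; case: a => //= e; congr (on_state u (inr _)).
  by apply/ffunP => i; rewrite ffunE [i]ord1.
apply: hom_eq => [a|[]] //=; exact: hsE.
Qed.

End CompleteArrow.

(** * Collapsing the states of a uniform system *)

Section StateCollapse.
Variables (Sigma : Type) (Z : ob (CSTS Sigma)).
Hypothesis Z_uniform : forall (u : action (sval Z)) a b c d,
  trans a [:: u] b -> trans c [:: u] d.

(** For a word of length at least two, uniformity makes every state an intermediate state of one
    2-transition, so the uniqueness in CSA2 leaves a single state. *)
Lemma uniform_trans s (a b c d : state (sval Z)) : trans a s b -> trans c s d.
Proof.
case: s => [|u [|v s]] ab; first by case: (trans_neq0 ab).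
  exact: Z_uniform ab.
suff same (e f : state (sval Z)) : e = f by rewrite (same c a) (same d b).
have [k ak] : exists k, trans a [:: u; v] k.
  case: s ab => [|w s] ab; first by exists b.
  by have [k [[ak _] _]] := csts_CSA2 (svalP Z) (u := [:: u; v]) (v := w :: s) isT isT ab; exists k.
have [l [[al lk] lU]] := csts_CSA2 (svalP Z) (u := [:: u]) (v := [:: v]) isT isT ak.
by rewrite -(lU e) ?(lU f) //; split; apply: Z_uniform; eassumption.
Qed.

(* The only state is a proof that Z has a state, so that the empty system is
   collapsed to itself. *)
Program Definition collapse_presystem : presystem Sigma :=
  @Presystem Sigma (inhabited (state (sval Z))) (action (sval Z)) (@label _ _)
    (fun _ s _ => exists a b, trans a s b) _.
Next Obligation. by move=> [c [d /trans_neq0]]. Qed.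

Lemma collapse_is_csts : is_csts collapse_presystem.
Proof.
split.
- move=> n t s a b n2 [c [d cd]]; exists c, d.
  exact: (csts_multiset (svalP Z)).
- move=> u v w ? ? ? ? u0 v0 w0 [a [b ab]] _ _ _ _.
  (* The middle word is cut out of the long transition of [Z] by applying CSA2 twice. *)
  have vw0 : (0 < size (v ++ w))%N by rewrite size_cat ltn_addr.
  have [c [[_ cb] _]] := csts_CSA2 (svalP Z) u0 vw0 ab.
  by have [d [[cd _] _]] := csts_CSA2 (svalP Z) v0 w0 cb; exists c, d.
- move=> u; have [a [b ab]] := csts_all_used (svalP Z) u.
  by exists (inhabits a), (inhabits b), a, b.
- move=> u v ? ? u0 v0 [a [b ab]].
  have [c [[ac cb] _]] := csts_CSA2 (svalP Z) u0 v0 ab.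
  exists (inhabits c); split=> [|d _]; 
    last exact: (@Prop_irrelevance (inhabited _)).
  by split; [exists a, c|exists c, b].
- move=> u v ? ? [a [b ab]] [c [d cd]].
  exact: (csts_CSA1 (svalP Z) ab (Z_uniform a b cd)).
Qed.

Definition collapse : ob (CSTS Sigma) := exist _ _ collapse_is_csts.

Lemma collapse_one_state : at_most_one_state collapse.
Proof. by move=> a b; apply: (@Prop_irrelevance (inhabited _)). Qed.

Program Definition collapse_map : hom Z collapse :=
  @TSMap _ (sval Z) collapse_presystem (@inhabits _) id _ _.
Next Obligation. by rewrite map_id; exists a, b. Qed.

Lemma collapse_map_inj : inj_class (@generating_cof Sigma) collapse_map.
Proof.
apply: cartesian_inj; first by exists id.
  by move=> y; case: (y) => a; exists a; apply: (@Prop_irrelevance (inhabited _)).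
by move=> c s d; rewrite map_id => -[a [b ab]]; apply: uniform_trans ab.
Qed.

End StateCollapse.

(** * Weak equivalences and orthogonality *)

Section WeakEquivalences.
Variables (Sigma : Type) (M : model_structure (CSTS Sigma)).
Hypothesis M_left_determined : left_determined_by (@generating_cof Sigma) M.
Implicit Types X Y Z : ob (CSTS Sigma).

Let weqE X Y (f : hom X Y) := proj2 M_left_determined X Y f.

Lemma inj_weq X Y (p : hom X Y) : inj_class (@generating_cof Sigma) p -> weq M p.
Proof. by move=> inj_p; apply/weqE => W HW; apply: localizer_inj HW _ _ _ inj_p. Qed.

Lemma iso_weq X Y (f : hom X Y) : is_iso f -> weq M f.
Proof. by move=> iso_f; apply: inj_weq => A B i _; apply: iso_lifts_right. Qed.

Lemma weq_orthogonal X Y (f : hom X Y) :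
  weq M f -> orthogonal (@at_most_one_state Sigma) f.
Proof.
move=> /weqE; apply; apply: orthogonal_localizer => X' Y' p.
exact: inj_orthogonal.
Qed.

(** Sending [T] to [a] retracts the inclusion of sets by a surjection, which is in inj; so the
    inclusion is a weak equivalence, and the pushout inherits this. *)
Lemma set_sum_inr_weq T X (a : state (sval X)) : weq M (set_sum_inr T X).
Proof.
pose r (s : T + state (sval X)) := match s with inl _ => a | inr b => b end.
have weq_i : weq M (set_map Sigma (@inr T (state (sval X)))).
  have [_ _] := weq_two_out_of_three M (set_map Sigma inr) (set_map Sigma r).
  apply; first by apply: inj_weq; apply: (@set_map_surj_inj _ _ _ _ inr).
  by apply: iso_weq; exists (idm _); split; apply: hom_eq.
apply/weqE => W HW; apply: (proj1 (localizer_pushout HW (set_sum_pushout T X) _)).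
by split; [move/weqE: weq_i; apply|apply: set_map_inr_cof].
Qed.

(** Two-out-of-three in the composite from [C_1] through the split arrow and its cylinder back to
    [C_1], which is the identity. *)
Lemma split_to_complete_weq x : weq M (split_to_complete x).
Proof.
have [_ + _] := weq_two_out_of_three M
  (set_sum_inr bool (cube [tuple x])) (split_to_complete x).
apply; first exact: (set_sum_inr_weq (X := cube [tuple x]) _ [ffun=> false]).
have [_ _] := weq_two_out_of_three M
  (split_to_complete x \oc set_sum_inr bool (cube [tuple x])) (complete_to_cube x).
apply; first by apply: inj_weq; apply: complete_to_cube_inj.
apply: iso_weq; rewrite (_ : _ \oc _ = idm _); first exact: iso_idm.
apply: hom_eq => [e|i] /=; last by rewrite [i]ord1.
by apply/ffunP => i; rewrite ffunE [i]ord1.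
Qed.

Lemma fib_uniform Z Y (p : hom Z Y) : at_most_one_state Y -> fib M p ->
  forall (u : action (sval Z)) a b c d, trans a [:: u] b -> trans c [:: u] d.
Proof.
move=> Y1 fib_p u a b c d ab.
pose f := split_map c d (erefl (label u)) ab.
have vl i : label (on_action p u) =
    label (p := complete_arrow_presystem (label u)) i by rewrite on_action_label.
have vt k s l : complete_arrow_trans k s l -> trans (on_state p a)
    (map (fun=> on_action p u) s) (on_state p a).
  (* As [Y] has at most one state, the image of the transition is a loop, so every state of the
     cylinder may go to [on_state p a]. *)
  case: s => [|? [|? ?]] [_ // _ _]; have := on_trans p ab.
  by rewrite (Y1 (on_state p b) (on_state p a)).
pose v : hom (complete_arrow (label u)) Y :=
  @TSMap _ (complete_arrow_presystem _) (sval Y) _ _ vl vt.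
have [|||h [hi _]] := trivial_cof_lifts (m := M) (i := split_to_complete (label u))
    (p := p) _ _ fib_p (u := f) (v := v).
- by apply/(proj1 M_left_determined); apply: split_to_complete_cof.
- exact: split_to_complete_weq.
- by apply: hom_eq => // e; apply: Y1.
(* In the cylinder, the two added states are joined by a transition, and the lift sends them to [c]
   and [d]. *)
have := on_trans h (a := (false, true)) (u := [:: tt]) (b := (true, true)).
have /= -> := on_state_eq hi (inl false).
have /= -> := on_state_eq hi (inl true).
by have /= -> := on_action_eq hi ord0; apply.
Qed.

Lemma orthogonal_weq X Y (e : hom X Y) : at_most_one_state Y ->
  orthogonal (@at_most_one_state Sigma) e -> weq M e.
Proof.
move=> Y1 orth_e; have [Z [j [p [cof_j weq_j fib_p pj]]]] := trivial_cof_factor M e.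
have [weq_comp _ _] := weq_two_out_of_three M j p.
rewrite -pj; apply: weq_comp => //.
have orth_p : orthogonal (@at_most_one_state Sigma) p.
  have [_ + _] := @orthogonal_two_out_of_three _ (@at_most_one_state Sigma)
    _ _ _ j p.
  by apply; [apply: weq_orthogonal|rewrite pj].
have Z_uniform := fib_uniform Y1 fib_p.
pose q := collapse_map Z_uniform.
have inj_q : inj_class (@generating_cof Sigma) q by apply: collapse_map_inj.
(* [p] factors through the collapse of [Z]; the factor [k] is orthogonal between one-state systems,
   hence an isomorphism. *)
have [k [kq _]] := inj_orthogonal inj_q Y1 p.
have [weq_comp' _ _] := weq_two_out_of_three M q k.
rewrite -kq; apply: weq_comp'; first exact: inj_weq.
apply: iso_weq; apply: (@orthogonal_iso _ (@at_most_one_state Sigma)) => //.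
  exact: collapse_one_state.
have [_ + _] := @orthogonal_two_out_of_three _ (@at_most_one_state Sigma)
    _ _ _ q k.
by apply; [apply: inj_orthogonal|rewrite kq].
Qed.

End WeakEquivalences.

Theorem theorem7p5 (Sigma : Type) (Sigma_inf : infinite_set [set: Sigma]%classic)
    (M : model_structure (CSTS Sigma))
    (M_left_determined : left_determined_by (@generating_cof Sigma) M)
    (Rperp : functor (CSTS Sigma) (CSTS1 Sigma))
    (A : adjunction Rperp (CSTS1_inclusion Sigma)) :
  quillen_equivalence M (discrete_model (CSTS1 Sigma)) A.
Proof.
split.
  split=> // X Y f _ weq_f; split=> //.
  by apply: (orthogonal_reflect_iso A); apply: weq_orthogonal weq_f.
(* Discrete weak equivalences are isomorphisms, and [f] is one exactly when its transpose is
   orthogonal. *)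
move=> X Y f _ _; split=> [/(is_iso_orthogonal A)|].
  exact: (orthogonal_weq M_left_determined (svalP Y)).
by move=> /(weq_orthogonal M_left_determined)/(is_iso_orthogonal A).
Qed.
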